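(* Let $p$ be a prime number, let $\mathcal{K}$ be a family of number fields stable by taking subfields, and let $\{\mathcal{X}_k\}_{k\in\mathcal{K}}$ be a family of finite invariants of $p$-power order with norms and transfers, as described in the context. Let $L/K$, with $K,L\in\mathcal{K}$, be a cyclic $p$-extension of degree $p^N$; for $n\in[0,N]$ let $K_n$ be the subfield of $L$ of degree $p^n$ over $K$ and put $\mathcal{X}_n:=\mathcal{X}_{K_n}$. Assume that, for all $n\in[0,N-1]$, the arithmetic norms $\mathcal{X}_{n+1}\to\mathcal{X}_n$ are surjective and the transfer maps $\mathcal{X}_n\to\mathcal{X}_{n+1}$ are injective. Let $p^{e_n}$ be the exponent of $\mathcal{X}_n$. Then $$\#\mathcal{X}_{n+h}\ \ge\ \#\mathcal{X}_n\cdot\#\mathcal{X}_n[p^h]\ \ge\ \#\mathcal{X}_n\cdot p^{\min(e_n,h)}$$ for all $n\in[0,N]$ and all $h\in[0,N-n]$, where $\mathcal{X}_n[p^h]:=\{x\in\mathcal{X}_n:\ x^{p^h}=1\}$.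
   Context: The family $\{\mathcal{X}_k\}_{k\in\mathcal{K}}$ consists of finite invariants (groups written multiplicatively) of $p$-power order, indexed by $\mathcal{K}$, fulfilling the following conditions for $k,k'\in\mathcal{K}$ with $k\subseteq k'$: (i) for any Galois extension $k'/k$, of Galois group $G$, $\mathcal{X}_{k'}$ is a $\mathbb{Z}_p[G]$-module; (ii) there exist norms $\mathbf{N}_{k'/k}:\mathcal{X}_{k'}\to\mathcal{X}_k$ (called arithmetic norms) and transfers $\mathbf{J}_{k'/k}:\mathcal{X}_k\to\mathcal{X}_{k'}$ such that $\mathbf{J}_{k'/k}\circ\mathbf{N}_{k'/k}=\nu_{k'/k}$, where $\nu_{k'/k}$ is the algebraic norm, i.e. the sum $\sum_{\tau\in G}\tau$ of the elements of $G=\mathrm{Gal}(k'/k)$; (iii) if $G=\mathrm{Gal}(k'/k)$ is a cyclic $p$-group, one defines the associated filtration $\{\mathcal{X}_{k'}^i\}_{i\ge 0}$ by $\mathcal{X}_{k'}^0=1$ and $\mathcal{X}_{k'}^{i+1}/\mathcal{X}_{k'}^i:=(\mathcal{X}_{k'}/\mathcal{X}_{k'}^i)^G$ for all $i\ge 0$. *)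

(* Defs.v *)
From HB Require Import structures.
From mathcomp Require Import all_boot all_order all_algebra all_fingroup.
From mathcomp Require Import all_solvable all_field.
From mathcomp Require Import boolp.

Set Implicit Arguments.
Unset Strict Implicit.
Unset Printing Implicit Defensive.

Import GRing.Theory.
Local Open Scope ring_scope.

(* Number fields are the subfields of algC, the algebraic closure of rat, that
   are finite-dimensional over rat; thus the inclusion of number fields is
   literally {subset k <= k'}. *)
Record numfield := NumField {
  nf_pred :> {pred algC};
  nf_divring : divring_closed nf_pred;
  nf_finite : exists s : seq algC, nf_pred =i Crat_span s
}.

HB.instance Definition _ (k : numfield) :=
  GRing.isDivringClosed.Build algC (nf_pred k) (nf_divring k).

Record nf_elt (k : numfield) := NfElt {
  nf_val : algC;
  nf_valP : nf_val \in nf_pred k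
}.

HB.instance Definition _ (k : numfield) := [isSub for @nf_val k].
HB.instance Definition _ (k : numfield) := [Choice of nf_elt k by <:].
HB.instance Definition _ (k : numfield) :=
  [SubChoice_isSubIntegralDomain of nf_elt k by <:].
HB.instance Definition _ (k : numfield) :=
  [SubIntegralDomain_isSubField of nf_elt k by <:].

(* The group of k-automorphisms of k', meant for k \subset k'. *)
Section Automorphisms.

Variables k k' : numfield.

Definition is_aut (f : nf_elt k' -> nf_elt k') : Prop :=
  [/\ zmod_morphism f, monoid_morphism f, bijective f
    & forall x, val x \in k -> f x = x].

Record nfgal := NfGal {
  nfgal_fun :> nf_elt k' -> nf_elt k';
  nfgal_subproof : `[< is_aut nfgal_fun >]
}.

HB.instance Definition _ := [isSub for nfgal_fun].
HB.instance Definition _ := [Choice of nfgal by <:].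

Lemma nfgalP (s : nfgal) : is_aut s.
Proof. exact/asboolP/nfgal_subproof. Qed.

Lemma nfgal_inj (s t : nfgal) : s =1 t -> s = t.
Proof. by move=> st; apply/val_inj/funext. Qed.

(* The automorphisms are finitely many: s is determined by the images of a
   finite rat-spanning family of k', which are roots of fixed polynomials. *)
Lemma nfgal_rmorph (s : nfgal) :
  {f : {rmorphism nf_elt k' -> nf_elt k'} | f =1 s}.
Proof.
have [sB sM _ _] := nfgalP s.
pose m1 := GRing.isZmodMorphism.Build _ _ (nfgal_fun s) sB.
pose m2 := GRing.isMonoidMorphism.Build _ _ (nfgal_fun s) sM.
pose f : {rmorphism _ -> _} :=
  HB.pack_for {rmorphism nf_elt k' -> nf_elt k'} (nfgal_fun s) m1 m2.
by exists f.
Qed.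

Lemma nfgal_root (s : nfgal) (x : nf_elt k') :
  root (minCpoly (val x)) (val (s x)).
Proof.
have [f fE] := nfgal_rmorph s.
have [q [-> _] dvq] := minCpolyP (val x).
have: root (map_poly ratr q) (val x) by rewrite dvq dvdpp.
have evalE (g : {rmorphism nf_elt k' -> algC}) y :
    (map_poly ratr q).[g y] = g (map_poly ratr q).[y].
  rewrite -horner_map -map_poly_comp /=; congr _.[_].
  by apply: eq_map_poly => a /=; rewrite fmorph_rat.
have := evalE val x => /= E1; have := evalE (val \o f) x => /= E2.
rewrite /root E1 -fE E2 -(rmorph0 (val : nf_elt k' -> algC)) => /eqP/val_inj ->.
by rewrite !rmorph0.
Qed.

Lemma nfgal_finite : {T : finType & {f : nfgal -> T | injective f}}.
Proof.
have /cid [b k'E] := nf_finite k'.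
have bk' i : i \in b -> i \in nf_pred k'.
  by move=> ib; rewrite k'E mem_Crat_span.
pose B : seq (nf_elt k') := pmap insub b.
have BE : map val B = b.
  rewrite /B (pmap_filter (insubK _)); apply/all_filterP/allP => x xb.
  by rewrite isSome_insub bk'.
have szB : size B = size b by rewrite -BE size_map.
have nthB n : (n < size b)%N -> val (nth 0 B n) = nth 0 b n.
  by move=> nb; rewrite -BE (nth_map 0) ?szB.
have /cid [rs rsP] : exists rs : seq (nf_elt k'),
    forall (s : nfgal) x, x \in B -> s x \in rs.
  elim: B {BE szB nthB} => [|x B [rs IH]]; first by exists [::].
  have [r rE] := closed_field_poly_normal (minCpoly (val x)).
  exists (pmap insub r ++ rs) => s y; rewrite inE mem_cat => /orP[/eqP->|yB].
    apply/orP; left; rewrite mem_pmap_sub /=.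
    have := nfgal_root s x; rewrite rE rootZ ?root_prod_XsubC //.
    by rewrite lead_coef_eq0 monic_neq0 ?minCpoly_monic.
  by apply/orP; right; apply: IH.
pose T := {ffun seq_sub B -> seq_sub rs}.
pose F (s : nfgal) : T := [ffun x => SeqSub (rsP s (ssval x) (ssvalP x))].
exists T, F => s t FE; apply: nfgal_inj => x.
have stB y : y \in B -> s y = t y.
  move=> yB; move/ffunP/(_ (SeqSub yB)): FE; rewrite !ffunE.
  by move/(congr1 val).
have [f fE] := nfgal_rmorph s; have [g gE] := nfgal_rmorph t.
rewrite -fE -gE.
have := valP x; rewrite {1}k'E => /Crat_spanP[a xE].
have {xE} -> : x = \sum_i ratr (a i) * nth 0 B i.
  apply: val_inj; rewrite xE (rmorph_sum (val : nf_elt k' -> algC)).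
  apply: eq_bigr => i _.
  rewrite (rmorphM (val : nf_elt k' -> algC)).
  by rewrite (fmorph_rat (val : nf_elt k' -> algC)) -nthB.
rewrite !rmorph_sum; apply: eq_bigr => i _.
rewrite (rmorphM f) (rmorphM g) !fmorph_rat.
by rewrite fE gE stB // mem_nth // szB.
Qed.

Definition nfgal_code : nfgal -> projT1 nfgal_finite :=
  sval (projT2 nfgal_finite).

Definition nfgal_decode (c : projT1 nfgal_finite) : option nfgal :=
  if pselect (exists s, nfgal_code s = c) is left e then Some (sval (cid e))
  else None.

Lemma nfgal_codeK : pcancel nfgal_code nfgal_decode.
Proof.
move=> s; rewrite /nfgal_decode; case: pselect => [e|]; last by case; exists s.
by congr Some; apply: (svalP (projT2 nfgal_finite)); case: (cid e).
Qed.

HB.instance Definition _ : isCountable nfgal :=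
  PCanIsCountable nfgal_codeK.
HB.instance Definition _ : isFinite nfgal := PCanIsFinite nfgal_codeK.

Lemma is_aut_id : is_aut id.
Proof. by split=> //; exists id. Qed.

Lemma is_aut_comp (s t : nfgal) : is_aut (t \o s).
Proof.
have [sB [s1 sM] sb sk] := nfgalP s; have [tB [t1 tM] tb tk] := nfgalP t.
split; first by move=> x y /=; rewrite sB tB.
- by split=> [|x y] /=; rewrite ?s1 ?t1 // sM tM.
- exact: bij_comp.
by move=> x xk /=; rewrite sk ?tk.
Qed.

Lemma is_aut_inv (s : nfgal) : {g | is_aut g & cancel s g}.
Proof.
have [sB [s1 sM] sb sk] := nfgalP s.
have /cid [g /all_and2 [sK gK]] : exists g, forall x, g (s x) = x /\ s (g x) = x.
  by case: sb => g sK gK; exists g.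
exists g => //; split.
- by move=> x y; rewrite -{1}[x]gK -{1}[y]gK -sB sK.
- split=> [|x y]; first by rewrite -[X in g X]s1 sK.
  by rewrite -{1}[x]gK -{1}[y]gK -sM sK.
- by exists s.
by move=> x xk; rewrite -{1}[x]sk ?sK.
Qed.

(* As for gal_of and perm in the library, products are in diagrammatic order:
   (s * t) x = t (s x). *)
Definition nfgal_one : nfgal := @NfGal id (asboolT is_aut_id).
Definition nfgal_mul (s t : nfgal) : nfgal :=
  @NfGal (t \o s) (asboolT (is_aut_comp s t)).
Definition nfgal_inv (s : nfgal) : nfgal :=
  @NfGal (s2val (is_aut_inv s)) (asboolT (s2valP (is_aut_inv s))).

Fact nfgal_mulA : associative nfgal_mul.
Proof. by move=> s t u; apply: nfgal_inj. Qed.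

Fact nfgal_mul1 : left_id nfgal_one nfgal_mul.
Proof. by move=> s; apply: nfgal_inj. Qed.

Fact nfgal_mulV : left_inverse nfgal_one nfgal_inv nfgal_mul.
Proof.
move=> s; apply: nfgal_inj => x /=; have [_ _ sb _] := nfgalP s.
by have /(bij_can_sym sb) := s2valP' (is_aut_inv s); apply.
Qed.

HB.instance Definition _ :=
  Finite_isGroup.Build nfgal nfgal_mulA nfgal_mul1 nfgal_mulV.

End Automorphisms.

(* Normality and separability, in Artin's form: k is the fixed field of the
   group of k-automorphisms of k'. *)
Definition nf_galois (k k' : numfield) : Prop :=
  {subset k <= k'} /\
  forall x : nf_elt k', (forall s : nfgal k k', s x = x) -> val x \in k.

(* [k' : k] = d, for k \subset k': some family b of size d is a basis of k'
   over k. *)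
Definition nf_degree (k k' : numfield) (d : nat) : Prop :=
  exists b : 'I_d -> nf_elt k',
    forall x : nf_elt k', exists! c : {ffun 'I_d -> nf_elt k},
      val x = \sum_i val (c i) * val (b i).

Local Open Scope group_scope.

(* A finite Z_p[G]-module of p-power order is an abelian p-group on which G
   acts by automorphisms, as the Z_p-module structure of a finite abelian
   p-group exists and is unique; right actions of nfgal are the usual left
   actions because of the diagrammatic order of products.
   The data are total functions, whose values are meaningful only when k and
   k' are in KK with k \subset k' (and k' Galois over k for inv_act). *)
Record invariant_family (p : nat) (KK : numfield -> Prop) := InvariantFamily {
  inv_group :> numfield -> finGroupType;
  inv_abelian : forall k, KK k -> abelian [set: inv_group k];
  inv_pgroup : forall k, KK k -> p.-group [set: inv_group k];
  inv_act : forall k k',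
    groupAction [set: nfgal k k'] [set: inv_group k'];
  inv_norm : forall k k', {morphism [set: inv_group k'] >-> inv_group k};
  inv_transfer : forall k k', {morphism [set: inv_group k] >-> inv_group k'};
  inv_transfer_norm : forall k k', KK k -> KK k' -> nf_galois k k' ->
    forall x : inv_group k',
      inv_transfer k k' (inv_norm k k' x) =
      \prod_(s : nfgal k k') inv_act k k' x s
}.

(* Main.v *)
(** One step of the tower.  If J N is the algebraic norm of a Galois extension
    of degree p, with N surjective and J injective, then N J is the p-th power
    map: for y = N x, the element J y = J (N x) is invariant under the Galois
    group, so J (N (J y)) is a product of p copies of J y.  Composing h steps
    gives a surjection N' : X_(n+h) -> X_n and an injection
    J' : X_n -> X_(n+h) such that N' (J' y) = y ^+ p^h, whence J' embeds
    X_n[p^h] in the kernel of N', which has order #X_(n+h) / #X_n.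

    It remains to see that K_(n+1) / K_n is Galois of degree p; for this L is
    made a splitting field over K, and the intermediate fields correspond to
    subgroups of a cyclic group, which are determined by their orders. *)

Require Import Defs.
From HB Require Import structures.
From mathcomp Require Import all_boot all_order all_algebra all_fingroup.
From mathcomp Require Import all_solvable all_field boolp.

Set Implicit Arguments.
Unset Strict Implicit.
Unset Printing Implicit Defensive.

Import GRing.Theory.

Local Open Scope ring_scope.

(** * Inclusions of number fields as ring morphisms *)

Definition nf_incl (k k' : numfield) (sub : {subset k <= k'}) (a : nf_elt k) :
  nf_elt k' := NfElt (sub _ (nf_valP a)).

Section Inclusion.

Variables (k k' : numfield) (sub : {subset k <= k'}).

Lemma nf_incl_is_zmod_morphism : zmod_morphism (nf_incl sub).
Proof. by move=> a b; apply: val_inj; rewrite !rmorphB. Qed.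

Lemma nf_incl_is_monoid_morphism : monoid_morphism (nf_incl sub).
Proof.
by split=> [|a b]; apply: val_inj; rewrite ?rmorphM ?rmorph1.
Qed.

HB.instance Definition _ := GRing.isZmodMorphism.Build _ _ (nf_incl sub)
  nf_incl_is_zmod_morphism.
HB.instance Definition _ := GRing.isMonoidMorphism.Build _ _ (nf_incl sub)
  nf_incl_is_monoid_morphism.

End Inclusion.

(* The unused proofs are arguments because the instances below, which make k' a
   splitting field over k, are built from them. *)
Definition nf_ext (k k' : numfield) (d : nat) of nf_galois k k' &
  nf_degree k k' d := nf_elt k'.

(** * A Galois extension of number fields as a splitting field over its base *)

Section Extension.

Variables (k k' : numfield) (d : nat).
Variables (gal : nf_galois k k') (deg : nf_degree k k' d).

Notation E := (nf_ext gal deg).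

HB.instance Definition _ := GRing.Field.on E.

Definition nf_ext_scale (a : nf_elt k) (x : E) : E := nf_incl gal.1 a * x.

Fact nf_ext_scaleA a b x :
  nf_ext_scale a (nf_ext_scale b x) = nf_ext_scale (a * b) x.
Proof. by rewrite /nf_ext_scale rmorphM mulrA. Qed.

Fact nf_ext_scale1 : left_id 1 nf_ext_scale.
Proof. by move=> x; rewrite /nf_ext_scale rmorph1 mul1r. Qed.

Fact nf_ext_scaleDr : right_distributive nf_ext_scale +%R.
Proof. by move=> a x y; apply: mulrDr. Qed.

Fact nf_ext_scaleDl x : {morph nf_ext_scale^~ x : a b / a + b}.
Proof. by move=> a b; rewrite /nf_ext_scale rmorphD mulrDl. Qed.

HB.instance Definition _ := GRing.Zmodule_isLmodule.Build (nf_elt k) E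
  nf_ext_scaleA nf_ext_scale1 nf_ext_scaleDr nf_ext_scaleDl.

Fact nf_ext_scaleAl (a : nf_elt k) (x y : E) : a *: (x * y) = a *: x * y.
Proof. exact: mulrA. Qed.

HB.instance Definition _ := GRing.Lmodule_isLalgebra.Build (nf_elt k) E
  nf_ext_scaleAl.

Fact nf_ext_scaleAr (a : nf_elt k) (x y : E) : a *: (x * y) = x * (a *: y).
Proof. exact: mulrCA. Qed.

HB.instance Definition _ := GRing.Lalgebra_isAlgebra.Build (nf_elt k) E
  nf_ext_scaleAr.

Lemma nf_extZ (a : nf_elt k) (x : E) : val (a *: x) = val a * val x.
Proof. by []. Qed.

Lemma nf_extP (a : nf_elt k) (x y : E) :
  val (a *: x + y) = val a * val x + val y.
Proof. by rewrite (rmorphD (val : nf_elt k' -> algC)). Qed.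

(** The coordinates in a basis [b] are chosen pointwise; their uniqueness makes the coordinate map
    linear and bijective. *)
Fact nf_ext_vect : Vector.axiom d E.
Proof.
have /cid [b bP] := deg.
have bE (c : {ffun 'I_d -> nf_elt k}) (x : E) :
  val x = \sum_i val (c i) * val (b i) <-> x = \sum_i c i *: (b i : E).
  have -> : \sum_i val (c i) * val (b i) = val (\sum_i c i *: (b i : E)).
    by rewrite (rmorph_sum (val : nf_elt k' -> algC)).
  by split=> [/val_inj|->].
pose c x := sval (cid (bP x)).
have cE (x : E) : x = \sum_i c x i *: (b i : E).
  by apply/bE; rewrite /c; case: cid => y [].
have c_uniq (x : E) (f : {ffun _ -> _}) :
    x = \sum_i f i *: (b i : E) -> c x = f.
  by move=> /bE xE; rewrite /c; case: cid => y [yE yU]; apply: yU.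
pose v2r (x : E) := \row_i c x i.
exists v2r.
  move=> a x y; apply/rowP=> i; rewrite !mxE.
  have -> : c (a *: x + y) = [ffun i => a * c x i + c y i].
    apply: c_uniq; rewrite {1}[x]cE {1}[y]cE scaler_sumr -big_split /=.
    by apply: eq_bigr => j _; rewrite ffunE scalerDl scalerA.
  by rewrite ffunE.
exists (fun r : 'rV_d => \sum_i r 0 i *: (b i : E)) => [x|r].
  by rewrite [RHS]cE; apply: eq_bigr => i _; rewrite mxE.
apply/rowP=> i; rewrite mxE (c_uniq _ [ffun i => r 0 i]) ?ffunE //.
by apply: eq_bigr => j _; rewrite ffunE.
Qed.

HB.instance Definition _ := Lmodule_hasFinDim.Build (nf_elt k) E nf_ext_vect.

Lemma mem1_nf_ext (x : E) : (x \in 1%VS) = (val x \in k).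
Proof.
apply/vlineP/idP=> [[a ->]|xk].
  by rewrite nf_extZ rmorph1 mulr1; apply: nf_valP.
by exists (NfElt xk); apply: val_inj; rewrite nf_extZ rmorph1 mulr1.
Qed.

(* The minimal polynomial of x divides the product of the 'X - s x over all s
   in nfgal k k', whose coefficients are invariant and hence in k. *)
Fact nf_ext_normal (U : {subfield E}) (x : E) :
  exists r, minPoly U x == \prod_(y <- r) ('X - y%:P).
Proof.
pose r : seq E := [seq s x | s : nfgal k k'].
have r_over : \prod_(y <- r) ('X - y%:P) \is a polyOver 1%VS.
  apply/polyOverP=> i; rewrite mem1_nf_ext; apply: gal.2 => s.
  have [f fE] := nfgal_rmorph s.
  rewrite -fE -coef_map rmorph_prod /= /r !big_image /=.
  congr ((_ : {poly _})`_i).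
  under eq_bigr => t _ do rewrite map_polyXsubC fE.
  (* Applying [s] only permutes the factors, through [t] to [t * s]. *)
  by rewrite [RHS](reindex_inj (mulIg s)).
have: minPoly U x %| \prod_(y <- r) ('X - y%:P).
  apply: minPoly_dvdp.
    by apply: polyOverSv r_over; apply: sub1v.
  rewrite root_prod_XsubC; apply/imageP; exists 1%g => //.
case/dvdp_prod_XsubC=> m; rewrite eqp_monic ?monic_minPoly ?monic_prod_XsubC //.
by exists (mask m r).
Qed.

HB.instance Definition _ :=
  FieldExt_isNormalSplittingField.Build (nf_elt k) E nf_ext_normal.

(** Normality comes from the splitting field structure, separability from characteristic zero. *)
Lemma galois_nf_ext (A : {subfield E}) : galois A {:E}.
Proof.
apply: (galoisS (K := 1)); first by rewrite sub1v subvf.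
rewrite /galois sub1v normalFieldf andbT; apply/separableP=> x _.
apply: pcharf0_separable => q.
by rewrite -(fmorph_pchar (val : nf_elt k' -> algC)) Num.Theory.pchar_num.
Qed.

(** [A] is the span in [E] of a basis of [M] over [k]; it is closed under products because [M]
    is. *)
Lemma nf_subfield (M : numfield) (m : nat) :
    {subset k <= M} -> {subset M <= k'} -> nf_degree k M m ->
  {A : {subfield E} | forall x : E, (x \in A) = (val x \in M) & \dim A = m}.
Proof.
move=> kM Mk' /cid[b bP].
pose v i : E := nf_incl Mk' (b i).
have sumE (c : 'I_m -> nf_elt k) :
    val (\sum_i c i *: v i) = \sum_i val (c i) * val (b i).
  by rewrite (rmorph_sum (val : nf_elt k' -> algC)).
pose X := [tuple v i | i < m].
have Xi (i : 'I_m) : X`_i = v i by rewrite nth_mktuple.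
have memX (x : E) : (x \in <<X>>%VS) = (val x \in M).
  apply/idP/idP=> [/coord_span ->|xM].
    under eq_bigr => i _ do rewrite Xi.
    rewrite sumE; apply: rpred_sum => i _; apply: rpredM; last exact: nf_valP.
    exact/kM/nf_valP.
  have [c [xE _]] := bP (NfElt xM).
  have -> : x = \sum_i c i *: v i by apply: val_inj; rewrite sumE -xE.
  by apply: rpred_sum => i _; rewrite rpredZ // memv_span // map_f ?mem_enum.
(* Zero has a single expansion in [b], so any vanishing combination has the coefficients of the
   trivial one. *)
have freeX : free X.
  apply/freeP=> c c0 i; have [d' [_ d'U]] := bP 0.
  have d'0 (f : {ffun 'I_m -> nf_elt k}) : \sum_i f i *: v i = 0 -> d' = f.
    by move=> f0; apply: d'U; rewrite -sumE f0 !rmorph0.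
  have := d'0 [ffun i => c i]; rewrite (d'0 0); last first.
    by rewrite big1 // => j _; rewrite ffunE scale0r.
  move/(_ _)/ffunP/(_ i); rewrite !ffunE => -> //.
  by rewrite -[RHS]c0; apply: eq_bigr => j _; rewrite ffunE Xi.
have aspX : is_aspace <<X>>%VS.
  rewrite /is_aspace has_algid1 /=; last by rewrite memX rpred1.
  apply/prodvP=> x y; rewrite !memX => xM yM.
  by rewrite (rmorphM (val : nf_elt k' -> algC)) rpredM.
by exists (ASpace aspX); rewrite //= (eqnP freeX) size_tuple.
Qed.

(** * Automorphism groups of intermediate extensions as Galois groups inside [E] *)

Section Correspondence.

Variables (k1 k2 : numfield) (A B : {subfield E}).
Hypotheses (sub12 : {subset k1 <= k2}) (sub2 : {subset k2 <= k'}).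
Hypotheses (AE : forall x : E, (x \in A) = (val x \in k1)).
Hypotheses (BE : forall x : E, (x \in B) = (val x \in k2)).

Let iota : nf_elt k2 -> E := nf_incl sub2.

Let sAB : (A <= B)%VS.
Proof. by apply/subvP=> x; rewrite AE BE; apply: sub12. Qed.

Let iota_mem x : iota x \in B. Proof. by rewrite BE; apply: nf_valP. Qed.

Let iota_surj (y : E) : y \in B -> exists x, y = iota x.
Proof. by rewrite BE => yk2; exists (NfElt yk2); apply: val_inj. Qed.

Let iotaB : {morph iota : x y / x - y} := rmorphB (nf_incl sub2).
Let iotaM : {morph iota : x y / x * y} := rmorphM (nf_incl sub2).

(** Elements of [gal_of B] arise from linear endomorphisms of all of [E], so [s] is extended to [E]
    by first projecting onto [B]. *)
Lemma nfgal_to_gal (s : nfgal k1 k2) :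
  {g : gal_of B | g \in 'Gal(B / A)%g & forall x, g (iota x) = iota (s x)}.
Proof.
have [f fE] := nfgal_rmorph s.
(* The default 0 is never taken: the projection lies in [B], that is, in [k2]. *)
pose pi (x : E) : nf_elt k2 := insubd 0 (val (projv B x)).
have piE x : val (pi x) = val (projv B x).
  by rewrite val_insubd -BE memv_proj.
pose h (x : E) : E := iota (f (pi x)).
have h_linear : linear h.
  move=> a x y; rewrite /h.
  (* The scalars lie in [k1], since [A] contains all multiples of 1; hence [s] fixes them. *)
  have ak1 : val a \in k1.
    have := AE (a *: 1); rewrite nf_extZ rmorph1 mulr1 => <-.
    by rewrite rpredZ ?mem1v.
  have -> : pi (a *: x + y) = NfElt (sub12 ak1) * pi x + pi y.
    apply: val_inj; rewrite piE linearP nf_extP.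
    by rewrite rmorphD rmorphM /= !piE.
  rewrite rmorphD rmorphM fE; have [_ _ _ ->] := nfgalP s; last exact: ak1.
  apply: val_inj; rewrite nf_extP.
  by rewrite !(_ : forall z, val (iota z) = val z) // rmorphD rmorphM.
pose hL : {linear E -> E} :=
  HB.pack h (GRing.isLinear.Build (nf_elt k) E E _ h h_linear).
have piK x : pi (iota x) = x.
  by apply: val_inj; rewrite piE projv_id.
have hiota x : linfun hL (iota x) = iota (f x).
  by rewrite lfunE /= /h piK.
have : kAut A B (linfun hL).
  rewrite kAutE; apply/andP; split; last first.
    by apply/subvP=> _ /memv_imgP[x _ ->]; rewrite lfunE; apply: iota_mem.
  apply/kHomP_tmp; split=> [x xA|x y].
    have [y xE] := iota_surj (subvP sAB _ xA).
    rewrite xE hiota fE; have [_ _ _ ->] // := nfgalP s.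
    by move: xA; rewrite AE xE.
  move=> /iota_surj[{}x ->] /iota_surj[{}y ->].
  by rewrite -iotaM !hiota rmorphM iotaM.
case/kAut_to_gal=> g gG hg; exists g => // x.
by rewrite -hg // hiota fE.
Qed.

Lemma gal_to_nfgal (g : gal_of B) :
  g \in 'Gal(B / A)%g -> {s : nfgal k1 k2 | forall x, iota (s x) = g (iota x)}.
Proof.
have sP (h : gal_of B) : {s | forall x, iota (s x) = h (iota x)}.
  have [|s] := @choice _ _ (fun x y => iota y = h (iota x)); last by exists s.
  by move=> x; have [y] := iota_surj (memv_gal h (iota_mem x)); exists y.
have iota_inj : injective iota by apply: fmorph_inj.
(* [t] serves as the inverse of [s]. *)
move=> gG; have [s sE] := sP g; have [t tE] := sP g^-1%g.
have s_aut : is_aut k1 s.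
  split=> [x y||| x xk1].
  - by apply: iota_inj; rewrite iotaB !sE iotaB rmorphB.
  - split=> [|x y]; apply: iota_inj.
      by rewrite sE [iota 1]rmorph1 rmorph1.
    by rewrite iotaM !sE iotaM rmorphM.
  - by exists t => x; apply: iota_inj;
      rewrite ?(sE, tE) -galM // ?(mulgV, mulVg) gal_id.
  by apply: iota_inj; rewrite sE (fixed_gal sAB gG) // AE.
by exists (NfGal (asboolT s_aut)).
Qed.

(** Products are in diagrammatic order on both sides, so the transport is a morphism and not an
    antimorphism. *)
Lemma nfgal_isog : ([set: nfgal k1 k2] \isog 'Gal(B / A))%g.
Proof.
pose phi s := s2val (nfgal_to_gal s).
have phiG s : phi s \in 'Gal(B / A)%g by rewrite /phi; case: (nfgal_to_gal s).
have phiE s x : phi s (iota x) = iota (s x).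
  by rewrite /phi; case: (nfgal_to_gal s).
have phiM : {in [set: nfgal k1 k2] &, {morph phi : s t / (s * t)%g}}.
  move=> s t _ _; apply/eqP/gal_eqP=> _ /iota_surj[x ->].
  by rewrite galM // !phiE.
apply/isogP; exists (Morphism phiM).
  apply/injmP=> s t _ _ /= st; apply: nfgal_inj => x.
  have: iota (s x) = iota (t x) by rewrite -!phiE st.
  exact: fmorph_inj.
apply/setP=> g; apply/morphimP/idP=> [[s _ _ ->] //|gG].
have [s sE] := gal_to_nfgal gG; exists s; rewrite ?inE //=.
by apply/eqP/gal_eqP=> _ /iota_surj[x ->]; rewrite phiE sE.
Qed.

(** Every element of the Galois group of [B] over [A] restricts from [nfgal k1 k2], so an
    [nfgal]-invariant element lies in the fixed field [A]. *)
Lemma galois_nf_galois : galois A B -> nf_galois k1 k2.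
Proof.
move=> /galois_fixedField fixA; split=> // x xfix.
have -> : val x = val (iota x) by [].
rewrite -AE -fixA; apply/fixedFieldP=> // g gG.
by have [s <-] := gal_to_nfgal gG; rewrite xfix.
Qed.

End Correspondence.

End Extension.

(** * Intermediate fields of a cyclic extension *)

(** In a cyclic group, divisibility of orders forces inclusion of subgroups. Passing to fixed fields
    yields the inclusion of [A] in [B], and commutativity makes the extension normal. *)
Lemma cyclic_galois_subfields (F : fieldType) (E : splittingFieldType F)
    (A B : {subfield E}) :
    galois 1 {:E} -> cyclic 'Gal({:E} / 1)%g -> (\dim A %| \dim B)%N ->
  galois A B.
Proof.
move=> galE cycE dvdAB.
have galC (C : {subfield E}) : galois C {:E}.
  by apply: galoisS galE; rewrite sub1v subvf.
have sGal (C : {subfield E}) : 'Gal({:E} / C)%g \subset 'Gal({:E} / 1)%g.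
  by apply: galS; apply: sub1v.
have sBA : 'Gal({:E} / B)%g \subset 'Gal({:E} / A)%g.
  rewrite -(cardSg_cyclic cycE (sGal B) (sGal A)).
  rewrite /= -!galois_dim //.
  have [dA dB] : (\dim A %| \dim {:E} /\ \dim B %| \dim {:E})%N.
    by split; apply: field_dimS; apply: subvf.
  (* The group orders are [\dim {:E} / \dim B] and [\dim {:E} / \dim A], so divisibility is
     reversed. *)
  by rewrite dvdn_divRL // -[X in (_ %| X)%N](divnK dB) dvdn_mul.
have /galois_fixedField <- := galC B.
apply: (normal_fixedField_galois (galC A) (G := 'Gal({:E} / B)%G)).
rewrite -sub_abelian_normal // cyclic_abelian //.
exact: cyclicS (sGal A) cycE.
Qed.

(** The inclusion of [M] in [M'] is a consequence of the degrees; this is what links consecutive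
    levels of the tower. *)
Lemma cyclic_intermediate (K L M M' : numfield) (d m m' : nat) :
    nf_galois K L -> cyclic [set: nfgal K L] -> nf_degree K L d ->
    {subset K <= M} -> {subset M <= L} -> nf_degree K M m ->
    {subset K <= M'} -> {subset M' <= L} -> nf_degree K M' m' ->
    (m %| m')%N ->
  nf_galois M M' /\ #|[set: nfgal M M']| = (m' %/ m)%N.
Proof.
move=> gal cyc deg KM ML degM KM' M'L degM' mm'.
pose E := nf_ext gal deg.
have [A AE dA] := nf_subfield gal deg KM ML degM.
have [B BE dB] := nf_subfield gal deg KM' M'L degM'.
(* Cyclicity is carried over by the correspondence for [K] and [L], seen as the subfields 1 and
   [{:E}]. *)
have cycE : cyclic 'Gal({:E} / 1)%g.
  have fullE (x : E) : (x \in {:E}%VS) = (val x \in L).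
    by rewrite memvf; apply/esym/nf_valP.
  have mem1 := @mem1_nf_ext _ _ _ gal deg.
  by rewrite -(isog_cyclic (nfgal_isog gal.1 _ mem1 fullE)).
have galAB : galois A B.
  apply: cyclic_galois_subfields cycE _; first exact: galois_nf_ext.
  by rewrite dA dB.
have MM' : {subset M <= M'}.
  move=> x xM; have [/subvP sAB _ _] := and3P galAB.
  by have := sAB (NfElt (ML x xM) : E); rewrite AE BE; apply.
split; first exact: galois_nf_galois MM' M'L AE BE galAB.
by rewrite (card_isog (nfgal_isog MM' M'L AE BE)) -galois_dim // dA dB.
Qed.

(* Norms, transfers and orders of finite groups *)
Local Close Scope ring_scope.
Local Open Scope group_scope.

Import FiniteModule.

Lemma prodg_act_invariant (aT rT : finGroupType)
    (to : groupAction [set: aT] [set: rT]) (x : rT) (s : aT) :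
    abelian [set: rT] ->
  to (\prod_(t : aT) to x t) s = \prod_(t : aT) to x t.
Proof.
move=> abR; rewrite (big_morph (to^~ s) (id1 := 1) (op1 := mulg)); first last.
- by rewrite gact1.
- by move=> y z; rewrite gactM.
under eq_bigr => t _ do rewrite -actMin ?inE //.
(* As a sum in the finite module attached to the abelian group, the product can be reindexed by [t]
   to [t * s]. *)
have prodE (f : aT -> rT) : \prod_t f t = fmval (\sum_t fmod abR (f t))%R.
  by rewrite fmval_sum; apply: eq_bigr => t _; rewrite fmodK ?inE.
by rewrite !prodE [in RHS](reindex_inj (mulIg s)).
Qed.

Lemma inv_norm_transfer (p : nat) (KK : numfield -> Prop)
    (X : invariant_family p KK) (k k' : numfield) :
    KK k -> KK k' -> nf_galois k k' ->
    (forall y : X k, exists x : X k', inv_norm X k k' x = y) ->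
    injective (inv_transfer X k k') ->
  forall y : X k,
    inv_norm X k k' (inv_transfer X k k' y) = y ^+ #|[set: nfgal k k']|.
Proof.
(* The two sides are compared after an application of the injective transfer. *)
move=> KKk KKk' gal surjN injJ y; apply: injJ; rewrite inv_transfer_norm //.
rewrite morphX ?inE //; have [x <-] := surjN y.
rewrite inv_transfer_norm //.
under eq_bigr => s _ do rewrite prodg_act_invariant ?inv_abelian //.
by rewrite big_const cardsT -Monoid.iteropE.
Qed.

(** The purely group-theoretic part: [f] stands for the norms and [g] for the transfers, constrained
    only up to level [N]. *)
Lemma card_tower (p N : nat) (G : nat -> finGroupType)
    (f : forall n, {morphism [set: G n.+1] >-> G n})
    (g : forall n, {morphism [set: G n] >-> G n.+1}) :
    (forall n, n < N -> forall y, exists x, f n x = y) ->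
    (forall n, n < N -> injective (g n)) ->
    (forall n, n < N -> forall y, f n (g n y) = y ^+ p) ->
  forall n h, n + h <= N ->
  (#|[set: G n]| * #|[set x : G n | x ^+ (p ^ h)%N == 1%g]| <=
     #|[set: G (n + h)]|)%N.
Proof.
move=> surj_f inj_g fg n h hN.
have [fc [gc [surj_fc inj_gc fgc]]] :
    exists (fc : {morphism [set: G (n + h)] >-> G n})
           (gc : {morphism [set: G n] >-> G (n + h)}),
      [/\ forall y, exists x, fc x = y, injective gc
        & forall y, fc (gc y) = y ^+ (p ^ h)%N].
  elim: h hN => [|h IH].
    rewrite addn0 => _; exists (idm_morphism [set: G n]).
    by exists (idm_morphism [set: G n]); split=> // y; exists y.
  rewrite addnS => hN; have [fc [gc [surj_fc inj_gc fgc]]] := IH (ltnW hN).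
  have fM : {in [set: G (n + h).+1] &, {morph fc \o f (n + h) : x y / x * y}}.
    by move=> x y _ _ /=; rewrite !morphM ?inE.
  have gM : {in [set: G n] &, {morph g (n + h) \o gc : x y / x * y}}.
    by move=> x y _ _ /=; rewrite !morphM ?inE.
  exists (Morphism fM), (Morphism gM); split=> /= [y||y].
  - have [z <-] := surj_fc y; have [x <-] := surj_f _ hN z.
    by exists x.
  - exact: inj_comp (inj_g _ hN) inj_gc.
  (* The innermost pair [f], [g] contributes a [p]-th power, which commutes with [fc]. *)
  by rewrite fg // morphX ?inE // fgc -expgM expnSr.
have im_fc : fc @* [set: G (n + h)] = [set: G n].
  apply/setP=> y; rewrite inE; have [x <-] := surj_fc y.
  by apply: mem_morphim; rewrite inE.
(* The index of the kernel is the order of the image, so it remains to bound the torsion by the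
   kernel. *)
rewrite -(Lagrange (subsetT ('ker fc))) -im_fc card_morphim setIid.
rewrite mulnC leq_mul2r; apply/orP; right.
rewrite -(card_imset _ inj_gc); apply/subset_leq_card/subsetP.
move=> _ /imsetP[x + ->].
by rewrite inE => /eqP xh; apply/kerP; rewrite ?inE // fgc.
Qed.

(** Nilpotency provides an element [x] whose order is the exponent; a suitable power of [x] has
    order [p ^ minn e h] and generates a subgroup of the torsion. *)
Lemma card_torsion_ge (p e h : nat) (gT : finGroupType) :
    prime p -> nilpotent [set: gT] -> exponent [set: gT] = (p ^ e)%N ->
  (p ^ minn e h <= #|[set x : gT | x ^+ (p ^ h)%N == 1%g]|)%N.
Proof.
move=> p_pr nilG; have [x _ ->] := exponent_witness nilG => ox.
set m := minn e h; pose y := x ^+ (p ^ (e - m))%N.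
have oy : #[y] = (p ^ m)%N.
  rewrite orderXdiv ox ?dvdn_exp2l ?leq_subr //.
  by rewrite -expnB ?prime_gt0 ?leq_subr // subKn ?geq_minl.
rewrite -oy; apply/subset_leq_card/subsetP=> z /order_dvdG zy.
rewrite inE -order_dvdn (dvdn_trans zy) // [#|_|]oy.
by rewrite dvdn_exp2l ?geq_minr.
Qed.

Theorem theorem3p2 (p : nat) (KK : numfield -> Prop)
    (X : invariant_family p KK) (K L : numfield) (N : nat)
    (F : nat -> numfield) (e : nat -> nat)
    (p_prime : prime p)
    (KK_stable : forall k k' : numfield, KK k' -> {subset k <= k'} -> KK k)
    (KK_K : KK K) (KK_L : KK L)
    (galKL : nf_galois K L) (cycKL : cyclic [set: nfgal K L])
    (degKL : nf_degree K L (p ^ N))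
    (F_def : forall n : nat, (n <= N)%N ->
      [/\ {subset K <= F n}, {subset F n <= L} & nf_degree K (F n) (p ^ n)])
    (norm_surj : forall n : nat, (n < N)%N ->
      forall y : X (F n), exists x : X (F n.+1),
        inv_norm X (F n) (F n.+1) x = y)
    (transfer_inj : forall n : nat, (n < N)%N ->
      injective (inv_transfer X (F n) (F n.+1)))
    (e_def : forall n : nat, (n <= N)%N ->
      exponent [set: X (F n)] = (p ^ e n)%N) :
  forall n h : nat, (n <= N)%N -> (h <= N - n)%N ->
    (#|[set: X (F (n + h))]|
       >= #|[set: X (F n)]| * #|[set x : X (F n) | (x ^+ (p ^ h)%N == 1)%g]|)%N
    /\
    (#|[set: X (F n)]| * #|[set x : X (F n) | (x ^+ (p ^ h)%N == 1)%g]|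
       >= #|[set: X (F n)]| * p ^ minn (e n) h)%N.
Proof.
have KKF n : n <= N -> KK (F n).
  by move=> /F_def[_ FL _]; apply: KK_stable FL.
(* Consecutive levels have degrees [p ^ n] and [p ^ n.+1] over [K], with quotient [p]. *)
have step n : n < N ->
    nf_galois (F n) (F n.+1) /\ #|[set: nfgal (F n) (F n.+1)]| = p.
  move=> nN; have [KFn FnL degn] := F_def n (ltnW nN).
  have [KFn1 Fn1L degn1] := F_def n.+1 nN.
  have [|gal ->] := cyclic_intermediate galKL cycKL degKL KFn FnL degn
    KFn1 Fn1L degn1; first by rewrite dvdn_exp2l.
  by rewrite expnSr mulKn // expn_gt0 prime_gt0.
move=> n h nN hN.
split; last first.
  rewrite leq_mul2l card_torsion_ge ?e_def ?orbT //.
  exact/abelian_nil/inv_abelian/KKF.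
apply: (@card_tower p N (fun n => X (F n))
  (fun n => inv_norm X (F n) (F n.+1)) (fun n => inv_transfer X (F n) (F n.+1)))
  => // [m mN y|].
  have [gal cardG] := step m mN.
  rewrite -[X in _ ^+ X]cardG; apply: inv_norm_transfer => //; first last.
  - exact: transfer_inj.
  - exact: norm_surj.
  - exact: KKF.
  exact/KKF/ltnW.
by rewrite -leq_subRL.
Qed.
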